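(* Let $m\ge1$, $\lambda>0$, let $M,N\ge0$ be integers and $K=\max\{M,N\}$. Let $\mathcal U,\mathcal V$ be positive definite linear functionals with respective sequences of monic orthogonal polynomials $\{P_n\}_{n\ge0}$, $\{Q_n\}_{n\ge0}$, forming a $(M,N)$-$D_\nu$-coherent pair of order $m$, i.e. $$P^{[m,\nu]}_{n}(x)+\sum_{i=1}^Ma_{i,n}P^{[m,\nu]}_{n-i}(x)=Q_n(x)+\sum_{i=1}^Nb_{i,n}Q_{n-i}(x),\qquad n\ge0,$$ where $a_{M,n}\ne0$ if $n\ge M$, $b_{N,n}\ne0$ if $n\ge N$, $a_{i,n}=b_{i,n}=0$ if $i>n$, and set $a_{0,n}=b_{0,n}=1$ for $n\ge0$. Let $\{S_n(x;\lambda,\nu)\}_{n\ge0}$ be the sequence of monic orthogonal polynomials with respect to $$\langle p,r\rangle_{\lambda,\nu}=\langle\mathcal U,p(x)r(x)\rangle+\lambda\langle\mathcal V,(D_\nu^mp)(x)(D_\nu^mr)(x)\rangle ,$$ and, for $n\ge0$, put $$s_{n,\nu}=\langle S_n(x;\lambda,\nu),S_n(x;\lambda,\nu)\rangle_{\lambda,\nu},\qquad \widetilde a_{i,n}=\frac{\eta_{n,m,\nu}}{\eta_{n-i,m,\nu}}a_{i,n},\qquad \widetilde b_{i,n}=\eta_{n,m,\nu}b_{i,n}.$$ Let $c_{j,n,\lambda,\nu}$ $(0\le j\le K,\ n\ge0)$ be the coefficients, with $c_{0,n,\lambda,\nu}=1$ for $n\ge0$ and $c_{j,n,\lambda,\nu}=0$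 for $n<j\le K$, such that $$P_{n+m}(x)+\sum_{i=1}^M\widetilde a_{i,n}P_{n-i+m}(x)=S_{n+m}(x;\lambda,\nu)+\sum_{j=1}^Kc_{j,n,\lambda,\nu}S_{n-j+m}(x;\lambda,\nu),\qquad n\ge0.$$ Then $$s_{n+m,\nu}\,c_{j,n+j,\lambda,\nu}=\zeta_{j,n,\lambda,\nu}-\sum_{\ell=1}^{K-j}c_{\ell,n,\lambda,\nu}\,c_{j+\ell,n+j,\lambda,\nu}\,s_{n-\ell+m,\nu},\qquad 0\le j\le K,\ n\ge0,$$ with $s_{n,\nu}=\langle\mathcal U,P_n^2(x)\rangle$ for $n<m$, where for $0\le j\le K$ $$\zeta_{j,n,\lambda,\nu}=\sum_{i=j}^M\widetilde a_{i,n+j}\,\widetilde a_{i-j,n}\,\langle\mathcal U,P_{n+j-i+m}^2(x)\rangle+\lambda\sum_{i=j}^N\widetilde b_{i,n+j}\,\widetilde b_{i-j,n}\,\langle\mathcal V,Q_{n+j-i}^2(x)\rangle .$$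
   Context: $\mathbb{P}$ is the space of polynomials with real coefficients; linear functionals are real linear maps on $\mathbb{P}$, and $\langle\mathcal U,p\rangle$ is the value of $\mathcal U$ at $p$. $\nu$ is either $\omega\in\mathbb{R}\setminus\{0\}$, with $D_\omega p(x)=\frac{p(x+\omega)-p(x)}{\omega}$, or $q\in\mathbb{R}\setminus\{0,\pm1\}$, with $D_qp(x)=\frac{p(qx)-p(x)}{(q-1)x}$ (the statement covers both cases). $D_\nu^m$ is the $m$-th iterate. A functional $\mathcal U$ with moments $u_n=\langle\mathcal U,x^n\rangle$ is positive definite if $\det[u_{i+j}]_{i,j=0}^n>0$ for all $n\ge0$. Its sequence of monic orthogonal polynomials (SMOP) is the sequence of monic $P_n$, $\deg P_n=n$, with $\langle\mathcal U,P_nP_k\rangle=\xi_n\delta_{n,k}$, $\xi_n\ne0$. The SMOP with respect to $\langle\cdot,\cdot\rangle_{\lambda,\nu}$ is defined analogously. $$P^{[m,\nu]}_{n}(x):=\frac{D_\nu^mP_{n+m}(x)}{\eta_{n,m,\nu}},\qquad \eta_{n,m,\omega}:=(n+1)(n+2)\cdots(n+m),\qquad \eta_{n,m,q}:=\frac{\prod_{i=1}^{m}(1-q^{n+i})}{(1-q)^m}.$$ The coefficients $c_{j,n,\lambda,\nu}$ in the claim exist and are unique: for a $(M,N)$-$D_\nu$-coherent pair of order $m$ the polynomial $P_{n+m}+\sum_{i=1}^M\widetilde a_{i,n}P_{n-i+m}$ has an expansion of the displayed form in the basis $\{S_k\}$, with $c_{j,n,\lambda,\nu}=0$ for $n<j\le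 K$. Conventions: $\widetilde a_{i,n}=\widetilde b_{i,n}=0$ for $i>n$, and every term containing a vanishing coefficient ($a_{i,n}$, $b_{i,n}$, $\widetilde a_{i,n}$, $\widetilde b_{i,n}$ with $i>n$, or $c_{j,n,\lambda,\nu}$ with $j>n$) is zero, even if the accompanying polynomial or $s_{k,\nu}$ has negative index. *)

(* Defs.v *)
From mathcomp Require Import all_boot all_order all_algebra.
From mathcomp Require Import reals.

Set Implicit Arguments.
Unset Strict Implicit.
Unset Printing Implicit Defensive.

Import Order.TTheory GRing.Theory Num.Theory.
Local Open Scope ring_scope.

Inductive difference (R : realType) : Type :=
  | Shift of R      (* the step omega of D_omega *)
  | Dilation of R.  (* the ratio q of D_q *)

Definition admissible (R : realType) (nu : difference R) : Prop :=
  match nu with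
  | Shift w => w != 0
  | Dilation q => [/\ q != 0, q != 1 & q != -1]
  end.

(* For D_q the polynomial division is exact, see [diff_opE]. *)
Definition diff_op (R : realType) (nu : difference R) (p : {poly R}) :
    {poly R} :=
  match nu with
  | Shift w => w^-1 *: (p \Po ('X + w%:P) - p)
  | Dilation q => (p \Po (q *: 'X) - p) %/ ((q - 1) *: 'X)
  end.

Lemma diff_opE (R : realType) (nu : difference R) (p : {poly R}) (x : R) :
  admissible nu ->
  match nu with
  | Shift w => (diff_op nu p).[x] = (p.[x + w] - p.[x]) / w
  | Dilation q =>
      x != 0 -> (diff_op nu p).[x] = (p.[q * x] - p.[x]) / ((q - 1) * x)
  end.
Proof.
case: nu => [w|q] /=; first by rewrite !hornerE horner_comp !hornerE mulrC.
case=> _ q1 _ x0.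
have q10 : q - 1 != 0 by rewrite subr_eq0.
have dvdq : ((q - 1) *: 'X) %| (p \Po (q *: 'X) - p).
  rewrite dvdpZl // -['X]subr0 -polyC0 dvdp_XsubCl /root.
  by rewrite !hornerE horner_comp !hornerE oppr0 mulr0 subrr.
have := congr1 (fun r => r.[x]) (divpK dvdq).
rewrite hornerM hornerZ hornerX hornerD hornerN horner_comp hornerZ hornerX.
by move=> <-; rewrite mulfK // mulf_neq0.
Qed.

Definition diff_iter (R : realType) (nu : difference R) (m : nat)
    (p : {poly R}) : {poly R} :=
  iter m (diff_op nu) p.

Definition eta (R : realType) (nu : difference R) (n m : nat) : R :=
  match nu with
  | Shift _ => \prod_(1 <= i < m.+1) (n + i)%:R
  | Dilation q => (\prod_(1 <= i < m.+1) (1 - q ^+ (n + i))) / (1 - q) ^+ m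
  end.

Definition normalized_diff (R : realType) (nu : difference R) (m : nat)
    (P : nat -> {poly R}) (n : nat) : {poly R} :=
  (eta nu n m)^-1 *: diff_iter nu m (P (n + m)%N).

Definition positive_definite (R : realType) (U : {scalar {poly R}}) : Prop :=
  forall n, 0 < \det (\matrix_(i < n.+1, j < n.+1) U 'X^(i + j)).

Definition monic_orthogonal (R : realType) (B : {poly R} -> {poly R} -> R)
    (P : nat -> {poly R}) : Prop :=
  (forall n, P n \is monic /\ size (P n) = n.+1) /\
  exists xi : nat -> R, (forall n, xi n != 0) /\
    forall n k, B (P n) (P k) = xi n * (n == k)%:R.

Definition functional_form (R : realType) (U : {scalar {poly R}})
    (p r : {poly R}) : R :=
  U (p * r).

Definition sobolev_form (R : realType) (U V : {scalar {poly R}}) (lambda : R)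
    (nu : difference R) (m : nat) (p r : {poly R}) : R :=
  U (p * r) + lambda * V (diff_iter nu m p * diff_iter nu m r).

(* Below, natural-number subtraction is truncated: every term whose index
   would be negative carries a vanishing coefficient. *)

Definition coherent_pair (R : realType) (M N : nat) (nu : difference R)
    (m : nat) (P Q : nat -> {poly R}) (a b : nat -> nat -> R) : Prop :=
  [/\ forall n, normalized_diff nu m P n +
          \sum_(1 <= i < M.+1) a i n *: normalized_diff nu m P (n - i) =
        Q n + \sum_(1 <= i < N.+1) b i n *: Q (n - i)%N,
      forall n, (M <= n)%N -> a M n != 0,
      forall n, (N <= n)%N -> b N n != 0,
      forall i n, (i <= M)%N -> (n < i)%N -> a i n = 0 &
      forall i n, (i <= N)%N -> (n < i)%N -> b i n = 0].

Definition tilde_a (R : realType) (nu : difference R) (m : nat)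
    (a : nat -> nat -> R) (i n : nat) : R :=
  eta nu n m / eta nu (n - i) m * a i n.

Definition tilde_b (R : realType) (nu : difference R) (m : nat)
    (b : nat -> nat -> R) (i n : nat) : R :=
  eta nu n m * b i n.

Definition zeta (R : realType) (M N : nat) (nu : difference R) (m : nat)
    (lambda : R) (U V : {scalar {poly R}}) (P Q : nat -> {poly R})
    (a b : nat -> nat -> R) (j n : nat) : R :=
  \sum_(j <= i < M.+1) tilde_a nu m a i (n + j) * tilde_a nu m a (i - j) n *
      U (P (n + j - i + m)%N ^+ 2) +
  lambda *
    \sum_(j <= i < N.+1) tilde_b nu m b i (n + j) * tilde_b nu m b (i - j) n *
      V (Q (n + j - i)%N ^+ 2).

(* Main.v *)
(** Let [A_n] denote either side of the expansion of the [P_{n+m}] in the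
    [S_{n+m}].  By coherence [D_nu^m A_n] is a short combination of the [Q_k],
    so the Sobolev product of [A_{n+j}] and [A_n] can be computed either from
    the orthogonality of [P] and [Q], which gives [zeta_{j,n}], or from that of
    [S].  Below degree [m] the operator [D_nu^m] vanishes and the Sobolev form
    is the one of [U]. *)
Require Import Defs.
From HB Require Import structures.
From mathcomp Require Import all_boot all_order all_algebra.
From mathcomp Require Import reals.
From mathcomp Require Import zify ring.

Set Implicit Arguments.
Unset Strict Implicit.
Unset Printing Implicit Defensive.

Import Order.TTheory GRing.Theory Num.Theory.
Local Open Scope ring_scope.

(** * Linearity and degree of the difference operators *)

Lemma diff_op_is_linear (R : realType) (nu : difference R) :
  linear (diff_op nu).
Proof.
move=> k p r; case: nu => [w|q] /=.
  by rewrite linearP /= opprD addrACA -scalerBr scalerDr !scalerA mulrC.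
by rewrite linearP /= opprD addrACA -scalerBr divpD divpZl.
Qed.

HB.instance Definition _ (R : realType) (nu : difference R) :=
  GRing.isLinear.Build R {poly R} {poly R} *:%R (diff_op nu)
    (diff_op_is_linear nu).

Lemma diff_iter_is_linear (R : realType) (nu : difference R) (m : nat) :
  linear (diff_iter nu m).
Proof.
move=> k p r; rewrite /diff_iter.
by elim: m => //= m ->; rewrite linearP.
Qed.

HB.instance Definition _ (R : realType) (nu : difference R) (m : nat) :=
  GRing.isLinear.Build R {poly R} {poly R} *:%R (diff_iter nu m)
    (diff_iter_is_linear nu m).

(** The shift case goes by induction on the polynomial. In the dilation case substituting [q *: 'X]
    does not raise the degree, and the quotient by a polynomial of degree one loses one degree. *)
Lemma size_diff_op (R : realType) (nu : difference R) (p : {poly R}) :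
  admissible nu -> (size (diff_op nu p) <= (size p).-1)%N.
Proof.
case: nu => [w|q] /= hnu.
  apply: leq_trans (size_scale_leq _ _) _.
  elim/poly_ind: p => [|p c IHp]; first by rewrite comp_poly0 subrr size_poly0.
  (* Product rule for the increment: the induction hypothesis bounds the first summand, and the
     second has at most the size of [p]. *)
  have -> : (p * 'X + c%:P) \Po ('X + w%:P) - (p * 'X + c%:P) =
            (p \Po ('X + w%:P) - p) * ('X + w%:P) + w *: p.
    rewrite comp_polyD comp_polyM comp_polyX comp_polyC -mul_polyC.
    by ring.
  have [->|p0] := eqVneq p 0.
    by rewrite comp_poly0 subrr mul0r scaler0 addr0 size_poly0.
  rewrite size_MXaddC (negPf p0) /=.
  apply: leq_trans (size_polyD _ _) _; rewrite geq_max size_scale_leq andbT.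
  apply: leq_trans (size_polyMleq _ _) _; rewrite size_XaddC addn2 /=.
  by rewrite -(prednK (_ : 0 < size p)%N) ?ltnS // size_poly_gt0.
case: hnu => _ q1 _.
have q10 : q - 1 != 0 by rewrite subr_eq0.
rewrite size_divp; last by rewrite scaler_eq0 (negPf q10) polyX_eq0.
rewrite size_scale // size_polyX subn1 -!subn1 leq_sub2r //.
apply: leq_trans (size_polyD _ _) _; rewrite size_polyN geq_max leqnn andbT.
have [->|p0] := eqVneq p 0; first by rewrite comp_poly0.
apply: leq_trans (size_comp_poly_leq _ _) _.
have sX : ((size (q *: 'X : {poly R})).-1 <= 1)%N.
  rewrite -subn1 leq_subLR addn1; apply: leq_trans (size_scale_leq _ _) _.
  by rewrite size_polyX.
rewrite -{2}(prednK (_ : 0 < size p)%N) ?size_poly_gt0 // ltnS.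
by rewrite -[leqRHS]muln1 leq_mul2l sX orbT.
Qed.

Lemma diff_iter_eq0 (R : realType) (nu : difference R) (m : nat)
    (p : {poly R}) :
  admissible nu -> (size p <= m)%N -> diff_iter nu m p = 0.
Proof.
move=> hnu hp; apply/eqP; rewrite -size_poly_leq0.
suff: (size (diff_iter nu m p) <= size p - m)%N.
  by move/leq_trans; apply; rewrite leqn0 subn_eq0.
rewrite /diff_iter; elim: m {hp} => [|m IHm] /=; first by rewrite subn0.
apply: leq_trans (size_diff_op _ hnu) _.
by rewrite subnS -!subn1 leq_sub2r.
Qed.

(* [Defs.eta] is qualified because MathComp's own [eta] shadows it here. *)
Lemma eta_neq0 (R : realType) (nu : difference R) (n m : nat) :
  admissible nu -> Defs.eta nu n m != 0.
Proof.
case: nu => [w|q] /= hnu.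
  rewrite prodf_seq_neq0; apply/allP => i; rewrite mem_index_iota => /andP[i0 _].
  by rewrite /= pnatr_eq0 addn_eq0 negb_and -(lt0n i) i0 orbT.
case: hnu => q0 q1 qN1; rewrite mulf_neq0 //; last first.
  by rewrite invr_eq0 expf_neq0 // subr_eq0 eq_sym.
rewrite prodf_seq_neq0; apply/allP => i; rewrite mem_index_iota => /andP[i0 _].
(* If [q ^+ (n + i) = 1] with a positive exponent, absolute values give [|q| = 1], so [q] would be 1
   or -1. *)
rewrite /= subr_eq0 eq_sym; apply/eqP => /(congr1 Num.norm) /eqP.
rewrite normrX normr1 pexprn_eq1 // addn_eq0 (gtn_eqF i0) andbF /=.
by rewrite eqr_norml ler01 andbT (negPf q1) (negPf qN1).
Qed.

(** * Orthogonal families for a bilinear form *)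

Section BilinearForm.
Variables (R : realType) (B : {poly R} -> {poly R} -> R).
Hypothesis linB : forall r, scalar (B^~ r).

Lemma form0l (r : {poly R}) : B 0 r = 0.
Proof. by have := linB r (-1) 0 0; rewrite scaler0 addr0 mulN1r addNr. Qed.

Lemma form_suml (I : Type) (s : seq I) (f : I -> R) (F : I -> {poly R})
    (r : {poly R}) :
  B (\sum_(i <- s) f i *: F i) r = \sum_(i <- s) f i * B (F i) r.
Proof.
by elim: s => [|i s IHs]; rewrite ?big_nil ?form0l // !big_cons linB IHs.
Qed.

Lemma monic_orthogonal_neq (F : nat -> {poly R}) (k l : nat) :
  monic_orthogonal B F -> k != l -> B (F k) (F l) = 0.
Proof. by case=> _ [xi [_ orthF]] /negPf kl; rewrite orthF kl mulr0. Qed.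

(** Induction on the size bound: a polynomial of size at most [k + 1] drops to size at most [k]
    after subtracting a suitable multiple of [F k], which is orthogonal to [F n] because [k < n]. *)
Lemma monic_orthogonal_lower (F : nat -> {poly R}) (n : nat) (p : {poly R}) :
  monic_orthogonal B F -> (size p <= n)%N -> B p (F n) = 0.
Proof.
case=> monicF [xi [_ orthF]].
suff H k : forall q : {poly R}, (size q <= k)%N -> (k <= n)%N -> B q (F n) = 0.
  by move=> hp; exact: H hp (leqnn n).
elim: k => [|k IHk] q hq kn.
  by move: hq; rewrite size_poly_leq0 => /eqP ->; rewrite form0l.
have [Fmonic Fsize] := monicF k.
rewrite -[q](subrK (q`_k *: F k)) addrC linB orthF (ltn_eqF kn) !mulr0 add0r.
apply: IHk (ltnW kn); apply/leq_sizeP => i; rewrite leq_eqVlt => /predU1P[<-|ki].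
  move: Fmonic; rewrite coefB coefZ monicE /lead_coef Fsize /= => /eqP ->.
  by rewrite mulr1 subrr.
have qi : q`_i = 0 by rewrite nth_default // (leq_trans hq ki).
by rewrite coefB coefZ qi [(F k)`_i]nth_default ?Fsize // mulr0 subrr.
Qed.

(** The leading terms of [p] and [F n] cancel, so [p - F n] has size at most [n] and is orthogonal
    to [F n]. *)
Lemma monic_orthogonal_pairing (F : nat -> {poly R}) (n : nat)
    (p : {poly R}) :
  monic_orthogonal B F -> p \is monic -> size p = n.+1 ->
  B p (F n) = B (F n) (F n).
Proof.
move=> hF pmonic psize; have [/(_ n)[Fmonic Fsize] _] := hF.
rewrite -[p](subrK (1 *: F n)) addrC linB mul1r scale1r.
rewrite [B (p - F n) _](monic_orthogonal_lower hF) ?addr0 //.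
apply/leq_sizeP => i; rewrite leq_eqVlt => /predU1P[<-|ki].
  move: Fmonic pmonic; rewrite coefB !monicE /lead_coef Fsize psize /=.
  by move=> /eqP -> /eqP ->; rewrite subrr.
by rewrite coefB !nth_default ?Fsize ?psize ?subrr.
Qed.

Hypothesis symB : commutative B.

Lemma form_sumr (I : Type) (s : seq I) (f : I -> R) (F : I -> {poly R})
    (r : {poly R}) :
  B r (\sum_(i <- s) f i *: F i) = \sum_(i <- s) f i * B r (F i).
Proof.
by rewrite symB form_suml; apply: eq_bigr => i _; rewrite symB.
Qed.

(** The indices [n + j - i] and [n - k] agree only for [k = i - j]. The vanishing of [f] and [g]
    removes the terms where truncated subtraction would create spurious coincidences at index 0.
    Only pairwise orthogonality is asked of [F], so that the shifted families [F (k + m)]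
    qualify. *)
Lemma form_orthogonal_sums (F : nat -> {poly R}) (K j n : nat)
    (f g : nat -> R) :
  (forall k l, k != l -> B (F k) (F l) = 0) ->
  (forall i, (i <= K)%N -> (n + j < i)%N -> f i = 0) ->
  (forall i, (i <= K)%N -> (n < i)%N -> g i = 0) ->
  B (\sum_(0 <= i < K.+1) f i *: F (n + j - i)%N)
    (\sum_(0 <= i < K.+1) g i *: F (n - i)%N) =
  \sum_(j <= i < K.+1)
    f i * g (i - j)%N * B (F (n + j - i)%N) (F (n + j - i)%N).
Proof.
move=> orthF f0 g0; rewrite form_suml.
transitivity (\sum_(0 <= i < K.+1 | (j <= i)%N)
    f i * g (i - j)%N * B (F (n + j - i)%N) (F (n + j - i)%N)); last first.
  (* The bound [K] will be [M] or [N], either of which [j] may exceed; both sums are then empty. *)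
  have [jK|Kj] := leqP j K.+1.
    by rewrite [RHS](big_nat_widenl _ 0%N).
  rewrite [RHS]big_geq ?(ltnW Kj) // big_nat_cond big1 // => i.
  case/andP=> /andP[_ iK] ji.
  by move: (leq_trans Kj ji); rewrite ltnNge (ltnW iK).
rewrite [RHS]big_mkcond; apply: eq_big_nat => i /andP[_ iK].
have [inj|inj] := leqP i (n + j)%N; last by rewrite f0 // !mul0r if_same.
rewrite form_sumr; case: ifPn => [ji|]; last rewrite -ltnNge => ij.
  have ijK : (i - j < K.+1)%N by apply: leq_ltn_trans (leq_subr _ _) iK.
  rewrite (bigD1_seq (i - j)%N) ?mem_index_iota ?iota_uniq //=.
  have -> : (n - (i - j) = n + j - i)%N by lia.
  rewrite big_nat_cond big1 ?addr0 ?mulrA // => k.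
  case/andP=> /andP[_ kK] kij.
  have [kn|kn] := leqP k n; last by rewrite g0 // mul0r.
  rewrite orthF ?mulr0 //; apply/eqP => /esym; move/eqP: kij; lia.
(* For [i < j] the left index [n + j - i] exceeds [n], so it meets no [n - k]. *)
rewrite big_nat_cond big1 ?mulr0 // => k /andP[/andP[_ kK] _].
have [kn|kn] := leqP k n; last by rewrite g0 // mul0r.
by rewrite orthF ?mulr0 //; apply/eqP; lia.
Qed.

End BilinearForm.

(** * The forms of the theorem and the coherence relation *)

Lemma functional_form_sym (R : realType) (U : {scalar {poly R}}) :
  commutative (functional_form U).
Proof. by move=> p r; rewrite /functional_form mulrC. Qed.

Lemma functional_form_scalar (R : realType) (U : {scalar {poly R}})
    (r : {poly R}) :
  scalar ((functional_form U)^~ r).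
Proof.
by move=> k p q; rewrite /functional_form mulrDl -scalerAl linearP.
Qed.

Lemma sobolev_formE (R : realType) (U V : {scalar {poly R}}) (lambda : R)
    (nu : difference R) (m : nat) (p r : {poly R}) :
  sobolev_form U V lambda nu m p r = functional_form U p r +
    lambda * functional_form V (diff_iter nu m p) (diff_iter nu m r).
Proof. by []. Qed.

Lemma sobolev_form_sym (R : realType) (U V : {scalar {poly R}}) (lambda : R)
    (nu : difference R) (m : nat) :
  commutative (sobolev_form U V lambda nu m).
Proof.
move=> p r.
by rewrite !sobolev_formE functional_form_sym (functional_form_sym V).
Qed.

Lemma sobolev_form_scalar (R : realType) (U V : {scalar {poly R}})
    (lambda : R) (nu : difference R) (m : nat) (r : {poly R}) :
  scalar ((sobolev_form U V lambda nu m)^~ r).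
Proof.
move=> k p q; rewrite !sobolev_formE linearP /= !functional_form_scalar.
by ring.
Qed.

(** The factor [eta n / eta (n - i)] in [tilde_a] turns the image of each term into [eta n] times
    the corresponding term of the coherence relation. *)
Lemma diff_iter_coherent (R : realType) (M N : nat) (nu : difference R)
    (m : nat) (P Q : nat -> {poly R}) (a b : nat -> nat -> R) (n : nat) :
  admissible nu -> coherent_pair M N nu m P Q a b ->
  diff_iter nu m (P (n + m)%N +
    \sum_(1 <= i < M.+1) tilde_a nu m a i n *: P (n - i + m)%N) =
  Defs.eta nu n m *: (Q n + \sum_(1 <= i < N.+1) b i n *: Q (n - i)%N).
Proof.
move=> hnu [<- _ _ _ _].
have etaK k : diff_iter nu m (P (k + m)%N) =
    Defs.eta nu k m *: normalized_diff nu m P k.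
  by rewrite scalerA divff ?scale1r ?eta_neq0.
rewrite raddfD /= raddf_sum /= etaK scalerDr scaler_sumr; congr (_ + _).
apply: eq_bigr => i _; rewrite linearZ /= etaK !scalerA /tilde_a.
by rewrite [_ * a i n]mulrAC divfK ?eta_neq0.
Qed.

Theorem theorem4p4 (R : realType) (nu : difference R) (m M N : nat)
    (lambda : R) (U V : {scalar {poly R}}) (P Q S : nat -> {poly R})
    (a b c : nat -> nat -> R)
    (hnu : admissible nu)
    (hm : (1 <= m)%N)
    (hlambda : 0 < lambda)
    (hU : positive_definite U)
    (hV : positive_definite V)
    (hP : monic_orthogonal (functional_form U) P)
    (hQ : monic_orthogonal (functional_form V) Q)
    (hPQ : coherent_pair M N nu m P Q a b)
    (ha0 : forall n : nat, a 0%N n = 1)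
    (hb0 : forall n : nat, b 0%N n = 1)
    (hS : monic_orthogonal (sobolev_form U V lambda nu m) S)
    (hc0 : forall n : nat, c 0%N n = 1)
    (hc : forall j n : nat, (n < j <= maxn M N)%N -> c j n = 0)
    (hPS : forall n : nat,
      P (n + m)%N +
        \sum_(1 <= i < M.+1) tilde_a nu m a i n *: P (n - i + m)%N =
      S (n + m)%N +
        \sum_(1 <= j < (maxn M N).+1) c j n *: S (n - j + m)%N) :
  let K := maxn M N in
  let s := fun n : nat => sobolev_form U V lambda nu m (S n) (S n) in
  (forall j n : nat, (j <= K)%N ->
     s (n + m)%N * c j (n + j)%N =
       zeta M N nu m lambda U V P Q a b j n -
       \sum_(1 <= l < (K - j).+1)
          c l n * c (j + l)%N (n + j)%N * s (n - l + m)%N) /\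
  (forall n : nat, (n < m)%N -> s n = U (P n ^+ 2)).
Proof.
move=> K s; split; last first.
  move=> n nm; have [monicS _] := hS; have [monicP _] := hP.
  have [[Sm Ss] [Pm Ps]] := (monicS n, monicP n).
  have D0 : diff_iter nu m (P n) = 0 by rewrite diff_iter_eq0 ?Ps.
  rewrite /s.
  (* One [S n] is replaced by [P n], which [diff_iter] kills; in the remaining value of [U],
     orthogonality of [P] replaces the other [S n]. *)
  rewrite -(monic_orthogonal_pairing (sobolev_form_scalar _ _ _ _ _) hS Pm Ps).
  rewrite sobolev_formE D0 /functional_form mul0r raddf0 mulr0 addr0 mulrC.
  exact: (monic_orthogonal_pairing (functional_form_scalar U) hP Sm Ss).
move=> j n jK.
(* The leading term is absorbed as [i = 0], since [tilde_a] equals 1 there. *)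
pose A k := \sum_(0 <= i < M.+1) tilde_a nu m a i k *: P (k - i + m)%N.
have AP k : P (k + m)%N +
    \sum_(1 <= i < M.+1) tilde_a nu m a i k *: P (k - i + m)%N = A k.
  rewrite /A [RHS]big_ltn // subn0 {2}/tilde_a ha0 mulr1 subn0.
  by rewrite divff ?scale1r ?eta_neq0.
have AS k : A k = \sum_(0 <= i < K.+1) c i k *: S (k - i + m)%N.
  by rewrite big_ltn // subn0 hc0 scale1r -hPS AP.
have AQ k : diff_iter nu m (A k) =
    \sum_(0 <= i < N.+1) tilde_b nu m b i k *: Q (k - i)%N.
  rewrite -AP (diff_iter_coherent _ hnu hPQ) [RHS]big_ltn // subn0 scalerDr.
  rewrite /tilde_b hb0 mulr1 scaler_sumr; congr (_ + _).
  by apply: eq_bigr => i _; rewrite scalerA.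
have [_ _ _ a0 b0] := hPQ.
have shift B F : @monic_orthogonal R B F ->
    forall k l, k != l -> B (F (k + m)%N) (F (l + m)%N) = 0.
  by move=> hF k l kl; rewrite (monic_orthogonal_neq hF) // eqn_add2r.
have zetaE : sobolev_form U V lambda nu m (A (n + j)%N) (A n) =
    zeta M N nu m lambda U V P Q a b j n.
  rewrite sobolev_formE !AQ /zeta; congr (_ + _ * _).
    rewrite (form_orthogonal_sums (functional_form_scalar U)
      (functional_form_sym U) (shift _ _ hP)) // => i iM ni.
    - by rewrite /tilde_a a0 ?mulr0.
    - by rewrite /tilde_a a0 ?mulr0.
  rewrite (form_orthogonal_sums (functional_form_scalar V)
    (functional_form_sym V)
    (fun k l => monic_orthogonal_neq hQ)) // => i iN ni.
  - by rewrite /tilde_b b0 ?mulr0.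
  - by rewrite /tilde_b b0 ?mulr0.
have c0 k i : (i <= K)%N -> (k < i)%N -> c i k = 0.
  by move=> iK ki; rewrite hc ?ki.
rewrite -zetaE !AS (form_orthogonal_sums (sobolev_form_scalar _ _ _ _ _)
  (sobolev_form_sym _ _ _ _ _) (shift _ _ hS)); [|exact: c0|exact: c0].
(* The term [i = j] carries [c 0 n = 1] and is the left-hand side sought; the others are reindexed
   by [i = j + l]. *)
rewrite big_ltn ?ltnS // subnn hc0 mulr1 addnK [s _ * _]mulrC.
rewrite -[j.+1]add1n big_addn subSn //.
apply/esym/eqP; rewrite subr_eq; apply/eqP; congr (_ + _).
apply: eq_big_nat => l _; rewrite addnK subnDr [(l + j)%N]addnC.
by rewrite [c l n * _]mulrC.
Qed.
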